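(* Let $K$ be a finite field with $q$ elements, let $s\geq 1$, let $w_1,\dots,w_s$ be positive integers with $\gcd(w_1,\dots,w_s)=1$, and put $\mathbf{w}=(w_1,\dots,w_s)$. Let $I_{\mathbb{T}}\subset K[t_1,\dots,t_s]$ be the vanishing ideal of the weighted projective torus $\mathbb{T}(w_1,\dots,w_s)$. Let $\mathcal{L}=(q-1)\bigl(\mathbf{w}^\perp\cap\mathbb{Z}^s\bigr)$ and let $I_{\mathcal{L}}\subset K[t_1,\dots,t_s]$ be the corresponding lattice ideal. Then $I_{\mathbb{T}}=I_{\mathcal{L}}$ and, in particular, $I_{\mathbb{T}}$ is $1$-dimensional and Cohen--Macaulay.
   Context: $\mathbb{N}=\{0,1,2,\dots\}$. The weighted projective space $\mathbb{P}(w_1,\dots,w_s)$ is the quotient $(K^s\setminus 0)/K^*$, where $\lambda\in K^*$ acts by $\lambda(x_1,\dots,x_s)=(\lambda^{w_1}x_1,\dots,\lambda^{w_s}x_s)$. The weighted projective torus is $\mathbb{T}(w_1,\dots,w_s)=\{(x_1,\dots,x_s)\in\mathbb{P}(w_1,\dots,w_s): x_1\cdots x_s\neq 0\}$. The polynomial ring $K[t_1,\dots,t_s]$ is graded by $\deg(t_i)=w_i$. The vanishing ideal of a set $X\subset\mathbb{P}(w_1,\dots,w_s)$ is the ideal of $K[t_1,\dots,t_s]$ generated by all homogeneous polynomials (for this grading) that vanish on $X$. $\mathbf{w}^\perp$ is the orthogonal of $\langle\mathbf{w}\rangle$ in $\mathbb{R}^s$ with respect to the canonical inner product. For $\mathbf{a}=(a_1,\dots,a_s)\in\mathbb{N}^s$,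 $t^{\mathbf{a}}=t_1^{a_1}\cdots t_s^{a_s}$. For a lattice $\mathcal{L}\subset\mathbb{Z}^s$ (a subgroup), the lattice ideal $I_{\mathcal{L}}\subset K[t_1,\dots,t_s]$ is the ideal generated by $t^{\mathbf{a}}-t^{\mathbf{b}}$ for all $\mathbf{a},\mathbf{b}\in\mathbb{N}^s$ with $\mathbf{a}-\mathbf{b}\in\mathcal{L}$. An ideal $I$ is called $1$-dimensional, respectively Cohen--Macaulay, if the quotient ring $K[t_1,\dots,t_s]/I$ has Krull dimension $1$, respectively is Cohen--Macaulay. *)

(* Defs.v *)
From HB Require Import structures.
From mathcomp Require Import all_boot all_order all_algebra.
From mathcomp Require Import generic_quotient ring_quotient boolp.
From mathcomp Require Import mpoly.
From mathcomp Require Import ring.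

Set Implicit Arguments.
Unset Strict Implicit.
Unset Printing Implicit Defensive.

Import GRing.Theory.
Local Open Scope ring_scope.
Local Open Scope quotient_scope.

Section Ideals.
Variable R : comPzRingType.

(* Membership predicates are boolean but need not be computable: through
   boolp every Prop-valued predicate has a boolean counterpart, so this
   covers all ideals. The unit ideal is allowed, unlike in ring_quotient. *)
Definition ideal_closed (I : {pred R}) :=
  [/\ 0 \in I, {in I &, forall x y, x + y \in I}
    & forall a, {in I, forall x, a * x \in I}].

Record ideal := Ideal {
  ideal_mem :> {pred R};
  idealP : ideal_closed ideal_mem }.

Definition gen_mem (S : R -> Prop) : {pred R} :=
  fun x => `[< exists n (c g : 'I_n -> R),
    (forall i, S (g i)) /\ x = \sum_i c i * g i >].

Lemma gen_closed S : ideal_closed (gen_mem S).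
Proof.
split.
- by apply/asboolP; exists 0, (fun=> 0), (fun=> 0); split=> [[]//|]; rewrite big_ord0.
- move=> x y /asboolP[n [c [g [Sg ->]]]] /asboolP[m [d [h [Sh ->]]]].
  apply/asboolP; exists (n + m)%N.
  exists (fun i => match split i with inl j => c j | inr j => d j end).
  exists (fun i => match split i with inl j => g j | inr j => h j end).
  split=> [i|]; first by case: (split i).
  rewrite big_split_ord /=; congr (_ + _); apply: eq_bigr => i _.
    by have /= -> := unsplitK (inl i : 'I_n + 'I_m).
  by have /= -> := unsplitK (inr i : 'I_n + 'I_m).
- move=> a x /asboolP[n [c [g [Sg ->]]]].
  apply/asboolP; exists n, (fun i => a * c i), g; split=> //.
  by rewrite mulr_sumr; apply: eq_bigr => i _; rewrite mulrA.
Qed.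

Definition gen_ideal (S : R -> Prop) : ideal := Ideal (gen_closed S).

Definition noetherian :=
  forall I : ideal, exists xs : seq R, I =i gen_ideal (fun x => x \in xs).

Definition is_prime (I : ideal) :=
  1 \notin I /\ forall x y, x * y \in I -> (x \in I) || (y \in I).

Record prime_ideal := PrimeIdeal {
  prime_val :> ideal;
  primeP : is_prime prime_val }.

Definition maximal (M : ideal) :=
  1 \notin M /\
  forall J : ideal, {subset M <= J} -> 1 \notin J -> {subset J <= M}.

(* P 0 < P 1 < ... < P n; the values of P beyond n are irrelevant. *)
Definition has_prime_chain (n : nat) :=
  exists P : nat -> prime_ideal, forall i, (i < n)%N ->
    {subset P i <= P i.+1} /\ ~ {subset P i.+1 <= P i}.

Definition krull_dim (d : nat) :=
  has_prime_chain d /\ forall n, has_prime_chain n -> (n <= d)%N.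

(* For each i, xs`_i is a nonzerodivisor on R / (xs`_0, ..., xs`_(i-1)), and
   R / (xs) is nonzero. *)
Definition regular_seq (xs : seq R) :=
  (forall i a, (i < size xs)%N ->
     let J := gen_ideal (fun x => x \in take i xs) in
     xs`_i * a \in J -> a \in J) /\
  1 \notin gen_ideal (fun x => x \in xs).

Definition has_regular_seq_in (I : ideal) (n : nat) :=
  exists xs : seq R,
    [/\ size xs = n, {subset xs <= I} & regular_seq xs].

Definition depth (I : ideal) (d : nat) :=
  has_regular_seq_in I d /\ forall n, has_regular_seq_in I n -> (n <= d)%N.

Definition is_local (M : ideal) :=
  maximal M /\ forall M' : ideal, maximal M' -> M' =i M.

Definition cohen_macaulay_local :=
  noetherian /\
  exists M d, [/\ is_local M, krull_dim d & depth M d].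

End Ideals.

Section IdealQuotient.
Variables (R : comPzRingType) (I : ideal R).

Lemma ideal_zmod_closed : zmod_closed (ideal_mem I).
Proof.
have [I0 ID IM] := idealP I; split=> // x y xI yI.
by rewrite -mulN1r; apply: ID => //; apply: IM.
Qed.

HB.instance Definition _ :=
  GRing.isZmodClosed.Build R (ideal_mem I) ideal_zmod_closed.

Definition quot_ring := {ideal_quot (ideal_mem I)}.

HB.instance Definition _ := GRing.Zmodule.on quot_ring.
HB.instance Definition _ :=
  EqQuotient.copy quot_ring {ideal_quot (ideal_mem I)}.

Definition quot_one : quot_ring := lift_cst quot_ring 1.
Definition quot_mul := lift_op2 quot_ring *%R.

Lemma quot_pi_eq (x y : R) :
  (\pi_quot_ring x = \pi_quot_ring y) <-> x - y \in ideal_mem I.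
Proof. by rewrite Quotient.idealrBE; split=> /eqP. Qed.

Lemma quot_pi_mul x y : \pi_quot_ring (x * y) = quot_mul (\pi x) (\pi y).
Proof.
have rP z : z - repr (\pi_quot_ring z) \in ideal_mem I.
  by apply/quot_pi_eq; rewrite reprK.
rewrite /quot_mul; unlock; apply/quot_pi_eq; set a := repr _; set b := repr _.
have -> : x * y - a * b = y * (x - a) + a * (y - b) by ring.
by have [_ ID IM] := idealP I; apply: ID; apply: IM; apply: rP.
Qed.

Fact quot_mulA : associative quot_mul.
Proof.
by move=> x y z; rewrite -[x]reprK -[y]reprK -[z]reprK -!quot_pi_mul mulrA.
Qed.
Fact quot_mulC : commutative quot_mul.
Proof. by move=> x y; rewrite -[x]reprK -[y]reprK -!quot_pi_mul mulrC. Qed.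
Fact quot_mul1 : left_id quot_one quot_mul.
Proof.
by move=> x; rewrite /quot_one; unlock; rewrite -[x]reprK -quot_pi_mul mul1r.
Qed.
Fact quot_mulDl : left_distributive quot_mul +%R.
Proof.
move=> x y z; rewrite -[x]reprK -[y]reprK -[z]reprK.
have piD a b : \pi_quot_ring (a + b) = \pi a + \pi b by exact: Quotient.pi_add.
by rewrite -piD -!quot_pi_mul -piD mulrDl.
Qed.

HB.instance Definition _ := GRing.Zmodule_isComPzRing.Build quot_ring
  quot_mulA quot_mulC quot_mul1 quot_mulDl.

End IdealQuotient.

Section Localization.
Variables (R : comPzRingType) (P : prime_ideal R).

Definition denom := {u : R | u \notin P}.

Definition frac_rel (x y : R * denom) : bool :=
  `[< exists u : denom, val u * (x.1 * val y.2 - y.1 * val x.2) = 0 >].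

Fact denom1_subproof : 1 \notin P. Proof. exact: (primeP P).1. Qed.
Definition denom1 : denom := 
  exist (fun u => is_true (u \notin P)) 1 denom1_subproof.

Fact denomM_subproof (u v : denom) : val u * val v \notin P.
Proof.
apply/negP => /(primeP P).2; apply/negP; rewrite negb_or.
by rewrite (valP u) (valP v).
Qed.
Definition denomM (u v : denom) : denom :=
  exist (fun u => is_true (u \notin P)) (val u * val v) (denomM_subproof u v).

Fact frac_equiv : equiv_class_of frac_rel.
Proof.
split=> [x|x y|y x z].
- by apply/asboolP; exists denom1; rewrite subrr mulr0.
- by apply/asboolP/asboolP => -[u]; rewrite -opprB mulrN => /eqP;
    rewrite oppr_eq0 => /eqP; exists u.
- move=> /asboolP[u Hu] /asboolP[v Hv]; apply/asboolP.
  exists (denomM (denomM u v) y.2) => /=.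
  have -> : val u * val v * val y.2 * (x.1 * val z.2 - z.1 * val x.2) =
    val v * val z.2 * (val u * (x.1 * val y.2 - y.1 * val x.2)) +
    val u * val x.2 * (val v * (y.1 * val z.2 - z.1 * val y.2)) by ring.
  by rewrite Hu Hv !mulr0 addr0.
Qed.

Canonical frac_equiv_rel := EquivRelPack frac_equiv.
Canonical frac_enc_rel := defaultEncModRel frac_rel.

Definition localization := {eq_quot frac_rel}.
HB.instance Definition _ : EqQuotient _ frac_rel localization :=
  EqQuotient.on localization.
HB.instance Definition _ := Choice.on localization.

Definition fracD (x y : R * denom) : R * denom :=
  (x.1 * val y.2 + y.1 * val x.2, denomM x.2 y.2).
Definition fracN (x : R * denom) : R * denom := (- x.1, x.2).
Definition fracM (x y : R * denom) : R * denom :=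
  (x.1 * y.1, denomM x.2 y.2).

Definition loc_zero : localization := lift_cst localization (0, denom1).
Definition loc_one : localization := lift_cst localization (1, denom1).
Definition loc_add := lift_op2 localization fracD.
Definition loc_opp := lift_op1 localization fracN.
Definition loc_mul := lift_op2 localization fracM.

Lemma loc_eq (x y : R * denom) : \pi_localization x = \pi y <->
  exists u : denom, val u * (x.1 * val y.2 - y.1 * val x.2) = 0.
Proof.
by split=> [/eqmodP/asboolP//|xy]; apply/eqmodP/asboolP.
Qed.

Lemma loc_eq1 (x y : R * denom) :
  x.1 * val y.2 = y.1 * val x.2 -> \pi_localization x = \pi y.
Proof. by move=> xy; apply/loc_eq; exists denom1; rewrite xy subrr mulr0. Qed.

Lemma loc_repr (x : R * denom) : exists u : denom,
  val u * (x.1 * val (repr (\pi_localization x)).2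
           - (repr (\pi_localization x)).1 * val x.2) = 0.
Proof. by apply/loc_eq; rewrite reprK. Qed.

Lemma loc_piD x y : \pi_localization (fracD x y) = loc_add (\pi x) (\pi y).
Proof.
rewrite /loc_add; unlock.
have [u Hu] := loc_repr x; have [v Hv] := loc_repr y.
move: (repr _) (repr _) Hu Hv => y' x' Hu Hv; apply/loc_eq.
exists (denomM u v) => /=.
set L := LHS; have -> : L =
  val v * val y.2 * val y'.2 * (val u * (x.1 * val x'.2 - x'.1 * val x.2)) +
  val u * val x.2 * val x'.2 * (val v * (y.1 * val y'.2 - y'.1 * val y.2)).
  by rewrite /L /=; ring.
by rewrite Hu Hv !mulr0 addr0.
Qed.

Lemma loc_piN x : \pi_localization (fracN x) = loc_opp (\pi x).
Proof.
rewrite /loc_opp; unlock.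
have [u Hu] := loc_repr x; move: (repr _) Hu => x' Hu; apply/loc_eq.
by exists u => /=; rewrite !mulNr -opprD mulrN Hu oppr0.
Qed.

Lemma loc_piM x y : \pi_localization (fracM x y) = loc_mul (\pi x) (\pi y).
Proof.
rewrite /loc_mul; unlock.
have [u Hu] := loc_repr x; have [v Hv] := loc_repr y.
move: (repr _) (repr _) Hu Hv => y' x' Hu Hv; apply/loc_eq.
exists (denomM u v) => /=.
set L := LHS; have -> : L =
  val v * y.1 * val y'.2 * (val u * (x.1 * val x'.2 - x'.1 * val x.2)) +
  val u * x'.1 * val x.2 * (val v * (y.1 * val y'.2 - y'.1 * val y.2)).
  by rewrite /L /=; ring.
by rewrite Hu Hv !mulr0 addr0.
Qed.

Fact loc_addA : associative loc_add.
Proof.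
move=> x y z; rewrite -[x]reprK -[y]reprK -[z]reprK -!loc_piD.
by apply: loc_eq1 => /=; ring.
Qed.
Fact loc_addC : commutative loc_add.
Proof.
by move=> x y; rewrite -[x]reprK -[y]reprK -!loc_piD; apply: loc_eq1 => /=; ring.
Qed.
Fact loc_add0 : left_id loc_zero loc_add.
Proof.
move=> x; rewrite /loc_zero; unlock; rewrite -[x]reprK -loc_piD.
by apply: loc_eq1 => /=; ring.
Qed.
Fact loc_addN : left_inverse loc_zero loc_opp loc_add.
Proof.
move=> x; rewrite /loc_zero; unlock; rewrite -[x]reprK -loc_piN -loc_piD.
by apply: loc_eq1 => /=; ring.
Qed.
HB.instance Definition _ :=
  GRing.isZmodule.Build localization loc_addA loc_addC loc_add0 loc_addN.

Fact loc_mulA : associative loc_mul.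
Proof.
move=> x y z; rewrite -[x]reprK -[y]reprK -[z]reprK -!loc_piM.
by apply: loc_eq1 => /=; ring.
Qed.
Fact loc_mulC : commutative loc_mul.
Proof.
by move=> x y; rewrite -[x]reprK -[y]reprK -!loc_piM; apply: loc_eq1 => /=; ring.
Qed.
Fact loc_mul1 : left_id loc_one loc_mul.
Proof.
move=> x; rewrite /loc_one; unlock; rewrite -[x]reprK -loc_piM.
by apply: loc_eq1 => /=; ring.
Qed.
Fact loc_mulDl : left_distributive loc_mul loc_add.
Proof.
move=> x y z; rewrite -[x]reprK -[y]reprK -[z]reprK -!loc_piM -!loc_piD -loc_piM.
by apply: loc_eq1 => /=; ring.
Qed.
HB.instance Definition _ := GRing.Zmodule_isComPzRing.Build localization
  loc_mulA loc_mulC loc_mul1 loc_mulDl.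

End Localization.

Definition cohen_macaulay (A : comPzRingType) :=
  noetherian A /\
  forall P : prime_ideal A, cohen_macaulay_local (localization P).

Section WeightedDegree.
Variables (s : nat) (w : 'I_s -> nat).

Definition wdeg (m : 'X_{1..s}) : nat := (\sum_i m i * w i)%N.

Lemma wdeg0 : wdeg 0%MM = 0%N.
Proof. by rewrite /wdeg big1 // => i _; rewrite mnm0E. Qed.
Lemma wdegD : {morph wdeg : m1 m2 / (m1 + m2)%MM >-> (m1 + m2)%N}.
Proof.
move=> m1 m2; rewrite /wdeg -big_split /=.
by apply: eq_bigr => i _; rewrite mnmDE mulnDl.
Qed.
HB.instance Definition _ := isMeasure.Build s wdeg wdeg0 wdegD.

End WeightedDegree.

Section WeightedProjectiveSpace.
Variables (K : finFieldType) (s : nat) (w : 'I_s -> nat).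

Definition nzvec := {x : 'rV[K]_s | x != 0}.

Definition wscale (l : K) (x : 'rV[K]_s) : 'rV[K]_s :=
  \row_i (l ^+ w i * x 0 i).

Definition wproj_rel (x y : nzvec) : bool :=
  [exists l : K, (l != 0) && (val y == wscale l (val x))].

Fact wproj_equiv : equiv_class_of wproj_rel.
Proof.
have sym x y : wproj_rel x y -> wproj_rel y x.
  move=> /existsP[l /andP[l0 /eqP e]]; apply/existsP; exists l^-1.
  rewrite invr_eq0 l0 e /=; apply/eqP/rowP => i; rewrite !mxE mulrA.
  by rewrite -exprMn mulVf // expr1n mul1r.
split=> [x|x y|y x z]; last 2 first.
- by apply/idP/idP; apply: sym.
- move=> /existsP[l /andP[l0 /eqP e]] /existsP[k /andP[k0 /eqP e']].
  apply/existsP; exists (k * l); rewrite mulf_neq0 //= e' e.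
  by apply/eqP/rowP => i; rewrite !mxE mulrA exprMn.
- apply/existsP; exists 1; rewrite oner_neq0 /=.
  by apply/eqP/rowP => i; rewrite !mxE expr1n mul1r.
Qed.

Canonical wproj_equiv_rel := EquivRelPack wproj_equiv.
Canonical wproj_enc_rel := defaultEncModRel wproj_rel.

Definition wproj := {eq_quot wproj_rel}.
HB.instance Definition _ : EqQuotient _ wproj_rel wproj := EqQuotient.on wproj.
HB.instance Definition _ := Choice.on wproj.

Definition wtorus : {pred wproj} :=
  fun p => [exists x : nzvec, (\pi_wproj x == p) && (\prod_i val x 0 i != 0)].

Definition vanishes_on (f : {mpoly K[s]}) (X : {pred wproj}) :=
  forall x : nzvec, \pi_wproj x \in X -> f.@[fun i => val x 0 i] = 0.

Definition vanishing_ideal (X : {pred wproj}) : ideal {mpoly K[s]} :=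
  gen_ideal (fun f : {mpoly K[s]} =>
    (exists d, f \is d.-homog for (wdeg w)) /\ vanishes_on f X).

End WeightedProjectiveSpace.

(* The integer points of the orthogonal complement of w. *)
Definition orth_lattice (s : nat) (w : 'I_s -> nat) : 'rV[int]_s -> Prop :=
  fun u => \sum_i u 0 i * (w i)%:Z = 0.

Definition torus_lattice (s q : nat) (w : 'I_s -> nat) : 'rV[int]_s -> Prop :=
  fun v => exists2 u, orth_lattice w u & v = u *+ (q - 1).

Definition lattice_ideal (K : fieldType) (s : nat) (L : 'rV[int]_s -> Prop)
    : ideal {mpoly K[s]} :=
  gen_ideal (fun f : {mpoly K[s]} => exists a b : 'X_{1..s},
    L (\row_i ((a i)%:Z - (b i)%:Z)) /\ f = 'X_[a] - 'X_[b]).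

(* Main.v *)
Require Import Defs.
From HB Require Import structures.
From mathcomp Require Import all_boot all_order all_algebra.
From mathcomp Require Import all_fingroup all_solvable all_field.
From mathcomp Require Import generic_quotient ring_quotient boolp.
From mathcomp Require Import mpoly.
From mathcomp Require Import ring zify.

(* Let G be the group of points of K^s with nonzero coordinates. For x in G,
   let psi_x : K[t_1, ..., t_s] -> K[z] send t_i to x_i z^(w_i). A polynomial
   vanishes under all psi_x iff all its homogeneous components vanish on the
   torus, so that I_T is the intersection of the primes ker psi_x;
   orthogonality of the characters of G shows that this intersection is spanned
   by the binomials of I_L.

   Let A be the quotient. Any two elements of K[z] are algebraically dependent.
   Applied to a and b in A with psi_x a <> 0, this yields
   b^k (1 + b b') + a c in ker psi_x. It follows that a prime strictly above
   some ker psi_x is maximal and contains an element outside every ker psi_x,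
   i.e. a nonzerodivisor of the reduced ring A. In the local ring at such a
   prime, every element of the maximal ideal is nilpotent modulo any
   nonzerodivisor, which bounds the depth by 1; at the minimal primes ker psi_x
   the maximal ideal of the local ring is zero. Finally, A is a finite module
   over K[t_i] for any i, hence noetherian. *)

Set Implicit Arguments.
Unset Strict Implicit.
Unset Printing Implicit Defensive.

Import GRing.Theory.
Local Open Scope ring_scope.
Local Open Scope quotient_scope.

(** * Ideals and primes *)

Section IdealTheory.
Variable A : comPzRingType.
Implicit Types (I J : ideal A) (P Q : prime_ideal A) (S : A -> Prop).

Lemma ideal0 I : 0 \in I. Proof. by case: (idealP I). Qed.

Lemma idealD I x y : x \in I -> y \in I -> x + y \in I.
Proof. by case: (idealP I) => _ + _; apply. Qed.

Lemma idealMl I a x : x \in I -> a * x \in I.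
Proof. by case: (idealP I) => _ _; apply. Qed.

Lemma idealMr I a x : x \in I -> x * a \in I.
Proof. by rewrite mulrC; apply: idealMl. Qed.

Lemma idealN I x : x \in I -> - x \in I.
Proof. by rewrite -mulN1r; apply: idealMl. Qed.

Lemma idealB I x y : x \in I -> y \in I -> x - y \in I.
Proof. by move=> Ix Iy; apply: idealD => //; apply: idealN. Qed.

Lemma ideal_sum I (T : Type) (r : seq T) (p : pred T) (F : T -> A) :
  (forall i, p i -> F i \in I) -> \sum_(i <- r | p i) F i \in I.
Proof.
by move=> IF; elim/big_rec: _ => [|i x pi]; [apply: ideal0 | apply/idealD/IF].
Qed.

Lemma mem_gen S x : S x -> x \in gen_ideal S.
Proof.
move=> Sx; apply/asboolP; exists 1%N, (fun=> 1), (fun=> x); split=> //.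
by rewrite big_ord1 mul1r.
Qed.

Lemma gen_sub S I : (forall x, S x -> x \in I) -> {subset gen_ideal S <= I}.
Proof.
move=> SI x /asboolP[n [c [g [Sg ->]]]].
by apply: ideal_sum => i _; apply/idealMl/SI.
Qed.

Lemma gen0P S x : (forall y, ~ S y) -> x \in gen_ideal S -> x = 0.
Proof.
move=> S0 /asboolP[n [c [g [Sg ->]]]]; apply: big1 => i _.
by case: (S0 _ (Sg i)).
Qed.

Lemma prime1 P : 1 \notin P. Proof. by case: (Defs.primeP P). Qed.

Lemma primeM P x y : x * y \in P -> x \in P \/ y \in P.
Proof. by case: (Defs.primeP P) => _ PM /PM/orP. Qed.

Lemma prime_notM P x y : x \notin P -> y \notin P -> x * y \notin P.
Proof. by move=> Px Py; apply/negP => /primeM[]; apply/negP. Qed.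

Lemma primeX P x n : x ^+ n \in P -> x \in P.
Proof.
elim: n => [|n IHn]; first by rewrite expr0 (negPf (prime1 P)).
by rewrite exprS => /primeM[].
Qed.

Lemma prime_prod P (T : finType) (p : pred T) (F : T -> A) :
  (forall i, p i -> F i \notin P) -> \prod_(i | p i) F i \notin P.
Proof.
by move=> PF; elim/big_rec: _ => [|i x /PF]; [apply: prime1 | apply: prime_notM].
Qed.

Lemma not_subsetP I J : ~ {subset I <= J} -> exists2 x, x \in I & x \notin J.
Proof.
move=> nIJ; apply: contrapT => nx; apply: nIJ => x Ix.
by apply/negP => /negP Jx; apply: nx; exists x.
Qed.

End IdealTheory.

(** * Localization at a prime *)

Section Localization.
Variables (A : comPzRingType) (P : prime_ideal A).
Implicit Types (a b : A) (u v : denom P).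
Local Notation L := (localization P).

Definition frac a u : L := \pi_(localization P) (a, u).

Definition mkdenom (a : A) (Pa : a \notin P) : denom P :=
  exist (fun x => is_true (x \notin P)) a Pa.

Lemma frac_surj (z : L) : exists a u, z = frac a u.
Proof.
by exists (repr z).1, (repr z).2; rewrite /frac -surjective_pairing reprK.
Qed.

Lemma frac_mul a b u v : frac a u * frac b v = frac (a * b) (denomM u v).
Proof. by rewrite /frac; have /= -> := loc_piM (a, u) (b, v). Qed.

Lemma frac_add a b u v :
  frac a u + frac b v = frac (a * val v + b * val u) (denomM u v).
Proof. by rewrite /frac; have /= -> := loc_piD (a, u) (b, v). Qed.

Lemma frac_eq a b u v :
  frac a u = frac b v <-> exists w : denom P, val w * (a * val v - b * val u) = 0.
Proof. exact: (loc_eq (a, u) (b, v)). Qed.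

Lemma frac_eq1 a b u v : a * val v = b * val u -> frac a u = frac b v.
Proof. by move=> e; apply: (loc_eq1 (x := (a, u)) (y := (b, v))). Qed.

Lemma frac1 u : 1 = frac (val u) u.
Proof.
have -> : (1 : L) = frac 1 (denom1 P) by rewrite -[1]/(loc_one P) /loc_one; unlock.
by apply: frac_eq1; rewrite /= mul1r mulr1.
Qed.

Lemma frac0 u : frac 0 u = 0.
Proof.
have -> : (0 : L) = frac 0 (denom1 P) by rewrite -[0]/(loc_zero P) /loc_zero; unlock.
by apply: frac_eq1; rewrite /= !mul0r.
Qed.

Lemma frac_eq0 a u : frac a u = 0 <-> exists w : denom P, val w * a = 0.
Proof.
rewrite -(frac0 (denom1 P)) frac_eq; split=> -[w e]; exists w; move: e => /=;
  by rewrite mul0r mulr1 subr0.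
Qed.

Definition tofrac a : L := frac a (denom1 P).

Lemma tofracM : {morph tofrac : a b / a * b}.
Proof. by move=> a b; rewrite frac_mul; apply: frac_eq1 => /=; ring. Qed.

Lemma tofracD : {morph tofrac : a b / a + b}.
Proof. by move=> a b; rewrite frac_add; apply: frac_eq1 => /=; ring. Qed.

Lemma tofrac1 : tofrac 1 = 1.
Proof. by rewrite (frac1 (denom1 P)). Qed.

Lemma tofracX a n : tofrac (a ^+ n) = tofrac a ^+ n.
Proof. by elim: n => [|n IHn]; rewrite ?tofrac1 // !exprS tofracM IHn. Qed.

Lemma tofrac_inv u : tofrac (val u) * frac 1 u = 1.
Proof. by rewrite frac_mul (frac1 u); apply: frac_eq1 => /=; ring. Qed.

Lemma fracE a u : frac a u = tofrac a * frac 1 u.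
Proof. by rewrite frac_mul; apply: frac_eq1 => /=; ring. Qed.

Lemma tofracE a u : tofrac a = frac a u * tofrac (val u).
Proof. by rewrite frac_mul; apply: frac_eq1 => /=; ring. Qed.

Lemma mem_frac (J : ideal L) a u : (frac a u \in J) = (tofrac a \in J).
Proof.
by apply/idP/idP => Ja; [rewrite (tofracE a u)|rewrite fracE]; apply: idealMr.
Qed.

Section Contraction.
Variable J : ideal L.

Definition contract_mem : {pred A} := fun a => tofrac a \in J.

Lemma contract_closed : ideal_closed contract_mem.
Proof.
split=> [|a b|a b]; rewrite !unfold_in /contract_mem.
- by rewrite /tofrac frac0; apply: ideal0.
- by rewrite tofracD; apply: idealD.
- by rewrite tofracM; apply: idealMl.
Qed.

Definition contract : ideal A := Ideal contract_closed.

Lemma mem_contract a : (a \in contract) = (tofrac a \in J).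
Proof. by []. Qed.

End Contraction.

Lemma contract_prime (Q : prime_ideal L) : is_prime (contract Q).
Proof.
split=> [|a b]; rewrite !mem_contract; first by rewrite tofrac1 prime1.
by rewrite tofracM => /primeM/orP.
Qed.

Definition prime_contract (Q : prime_ideal L) := PrimeIdeal (contract_prime Q).

Lemma contract_sub (Q : prime_ideal L) : {subset prime_contract Q <= P}.
Proof.
move=> a Qa; apply/negP => /negP Pa; case/negP: (prime1 Q).
by rewrite -(tofrac_inv (mkdenom Pa)); apply: idealMr.
Qed.

Lemma contract_subset (J J' : ideal L) :
  {subset contract J <= contract J'} <-> {subset J <= J'}.
Proof.
split=> sJ x; last by rewrite !mem_contract; apply: sJ.
by have [a [u ->]] := frac_surj x; rewrite !mem_frac -!mem_contract; apply: sJ.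
Qed.

Section Extension.
Variable Q : prime_ideal A.
Hypothesis QP : {subset Q <= P}.

Definition extend_mem : {pred L} :=
  fun z => `[< exists a u, a \in Q /\ z = frac a u >].

(** Denominators lie outside [P], hence outside [Q], so primality cancels them and membership does
    not depend on the representative of a fraction. *)
Lemma mem_extend a u : (frac a u \in extend_mem) = (a \in Q).
Proof.
apply/asboolP/idP => [[b [v [Qb /frac_eq[w]]]]|Qa]; last by exists a, u.
move/eqP; rewrite mulrBr subr_eq0 => /eqP e.
have : val w * (a * val v) \in Q by rewrite e; apply/idealMl/idealMr.
have notQ (t : denom P) : val t \in Q -> False.
  by move=> /QP Pt; have := valP t; rewrite Pt.
by case/primeM => [/notQ//|/primeM[//|/notQ]].
Qed.

Lemma extend_closed : ideal_closed extend_mem.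
Proof.
split=> [|x y|x y].
- by rewrite -(frac0 (denom1 P)) mem_extend ideal0.
- have [a [u ->]] := frac_surj x; have [b [v ->]] := frac_surj y.
  rewrite frac_add !mem_extend => Qa Qb.
  by apply: idealD; apply: idealMr.
- have [a [u ->]] := frac_surj x; have [b [v ->]] := frac_surj y.
  by rewrite frac_mul !mem_extend; apply: idealMl.
Qed.

Definition extend : ideal L := Ideal extend_closed.

Lemma extend_prime : is_prime extend.
Proof.
split=> [|x y]; first by rewrite (frac1 (denom1 P)) mem_extend prime1.
have [a [u ->]] := frac_surj x; have [b [v ->]] := frac_surj y.
by rewrite frac_mul !mem_extend => /primeM/orP.
Qed.

Definition prime_extend := PrimeIdeal extend_prime.

End Extension.

Definition loc_max : prime_ideal L := prime_extend (fun a (Pa : a \in P) => Pa).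

Lemma mem_loc_max a u : (frac a u \in loc_max) = (a \in P).
Proof. exact: mem_extend. Qed.

(** A fraction with numerator outside [P] is invertible, so no proper ideal contains it. *)
Lemma sub_loc_max (J : ideal L) : 1 \notin J -> {subset J <= loc_max}.
Proof.
move=> J1 x; have [a [u ->]] := frac_surj x; rewrite mem_loc_max mem_frac => Ja.
apply/negP => /negP Pa; case/negP: J1.
by rewrite -(tofrac_inv (mkdenom Pa)); apply: idealMr.
Qed.

Lemma loc_is_local : is_local loc_max.
Proof.
split=> [|M' [M'1 maxM']].
  by split=> [|J _]; [apply: prime1 | apply: sub_loc_max].
move=> x; apply/idP/idP; first exact: sub_loc_max.
by apply: maxM'; [apply: sub_loc_max | apply: prime1].
Qed.

Lemma loc_noetherian : noetherian A -> noetherian L.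
Proof.
move=> noeA J; have [xs xsJ] := noeA (contract J).
have gen_xs x : x \in xs -> tofrac x \in J.
  by move=> xs_x; rewrite -mem_contract xsJ mem_gen.
exists [seq tofrac x | x <- xs] => z; apply/idP/idP; last first.
  by apply: gen_sub => _ /mapP[x xs_x ->]; apply: gen_xs.
have [a [u ->]] := frac_surj z.
rewrite !mem_frac -!mem_contract; move: a; suff: {subset contract J <=
  contract (gen_ideal (fun x => x \in [seq tofrac x | x <- xs]))} by [].
move=> a; rewrite xsJ; apply: gen_sub => x xs_x.
by rewrite mem_contract mem_gen // map_f.
Qed.

(** Contraction preserves and reflects inclusions, so strict chains stay strict; bounds on chains of
    primes inside [P] thus bound the dimension of the local ring. *)
Lemma loc_chain n : has_prime_chain L n ->
  exists Q : nat -> prime_ideal A,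
    (forall i, {subset Q i <= P}) /\ forall i, (i < n)%N ->
    {subset Q i <= Q i.+1} /\ ~ {subset Q i.+1 <= Q i}.
Proof.
move=> [Q chQ]; exists (prime_contract \o Q); split=> [i|i /chQ[sQ nsQ]].
  exact: contract_sub.
by split; [apply/contract_subset | move/contract_subset].
Qed.

Lemma loc_chain1 (Q : prime_ideal A) a :
  {subset Q <= P} -> a \in P -> a \notin Q -> has_prime_chain L 1.
Proof.
move=> QP Pa Qa; exists (fun i => if i == 0%N then prime_extend QP else loc_max).
case=> //= _; split=> [x|sPQ].
  have [b [u ->]] := frac_surj x; rewrite mem_loc_max => Qb.
  by apply: (QP); rewrite -(mem_extend QP b u).
case/negP: Qa; rewrite -(mem_extend QP a (denom1 P)).
by apply: sPQ; rewrite mem_loc_max.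
Qed.

End Localization.

(** * Algebraic dependence in one variable *)

(** For nonconstant [g], the variable of K[z] is integral over K[g], and [f] is a polynomial in it
    with constant coefficients. *)
Lemma poly_integral (K : fieldType) (f g : {poly K}) :
  (1 < size g)%N -> integralOver (comp_poly g) f.
Proof.
move=> g_gt1; have g0 : lead_coef g != 0.
  by rewrite lead_coef_eq0 -size_poly_gt0 ltnW.
have intC (c : K) : integralOver (comp_poly g) c%:P.
  by rewrite -(comp_polyC c g); apply: integral_id.
set h := (lead_coef g)^-1 *: g.
have mon_h : h \is monic by rewrite monicE lead_coefZ mulVf.
have size_h : size h = size g by rewrite size_scale ?invr_neq0.
(* ['X] is a root of h(Y) - h, which is monic in the new variable Y and has its coefficients in
   K[g]. *)
have intX : integralOver (comp_poly g) 'X.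
  have size_hC : (size h%:P < size (map_poly polyC h))%N.
    by rewrite size_map_polyC size_h (leq_ltn_trans (size_polyC_leq1 _)).
  apply: (@integral_root_monic _ _ _ 'X (map_poly polyC h - h%:P)).
  - by rewrite monicE lead_coefDl ?size_polyN // -monicE map_monic.
  - by rewrite rootE hornerD hornerN hornerC -/(h \Po 'X) comp_polyXr subrr.
  apply/integral_poly => i; rewrite coefB coef_map /=; apply: integral_sub => //.
  rewrite coefC; case: eqP => _; last exact: integral0.
  rewrite /h -mul_polyC; apply: integral_mul => //.
  by rewrite -{2}(comp_polyX g); apply: integral_id.
rewrite -(comp_polyXr f); apply: integral_horner => //.
by apply/integral_poly => i; rewrite coef_map /=.
Qed.

Section Dependence.
Variables (K : fieldType) (A : comPzRingType) (psi : {rmorphism A -> {poly K}}).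
Hypothesis psiC : forall c : K, exists a, psi a = c%:P.

Lemma psi_comp q b : exists a, psi a = q \Po psi b.
Proof.
elim/poly_ind: q => [|q c [a IHa]]; first by exists 0; rewrite comp_poly0 rmorph0.
have [c' c'E] := psiC c; exists (a * b + c').
by rewrite comp_poly_MXaddC rmorphD rmorphM IHa c'E.
Qed.

(** Splitting off the constant term leaves a cofactor in the image of [psi], so that it lifts to
    [A]. *)
Lemma psi_comp_split q b :
  exists c, q \Po psi b = q.[0]%:P + psi b * psi c.
Proof.
elim/poly_ind: q => [|q c _].
  by exists 0; rewrite comp_poly0 horner0 rmorph0 mulr0 addr0.
have [a aE] := psi_comp q b; exists a.
by rewrite comp_poly_MXaddC hornerMXaddC mulr0 add0r aE addrC mulrC.
Qed.

(* Both [psi a] and [psi b] are polynomials in one variable, hence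
   algebraically dependent: [F (psi b, psi a) = 0] for some [F] not divisible
   by its second variable. Up to a scalar, [F (b, 0) = b ^+ k * (1 + b * b')]. *)
Lemma psi_dependence a b : psi a != 0 ->
  exists k b' c, psi (b ^+ k * (1 + b * b') + a * c) = 0.
Proof.
move=> a0; have [|a_le1] := ltnP 1 (size (psi a)); last first.
  (* Here [psi a] is a nonzero constant, and [c] is a lift of its negated inverse. *)
  have aE := size1_polyC a_le1; have [c cE] := psiC (- ((psi a)`_0)^-1).
  exists 0%N, 0, c; rewrite mulr0 addr0 mulr1 rmorphD rmorph1 rmorphM cE aE.
  rewrite -polyCM mulrN coefC eqxx mulfV ?polyCN ?subrr //.
  by apply: contraNneq a0 => a00; rewrite aE a00.
case/(poly_integral (psi b)) => F monF /eqP.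
(* The outer variable of [G] stands for [psi b], the inner one for [psi a]; setting the inner one to
   0 changes the value by a multiple of [psi a]. *)
have splitF (G : {poly {poly K}}) : exists c,
    (map_poly (comp_poly (psi a)) G).[psi b] =
    map_poly (horner_eval 0) G \Po psi b + psi a * psi c.
  elim/poly_ind: G => [|G q [c IHc]].
    by exists 0; rewrite !rmorph0 horner0 mulr0 addr0.
  have [d dE] := psi_comp_split q a; exists (c * b + d).
  rewrite !rmorphD !rmorphM /= !map_polyX !map_polyC /= hornerMXaddC.
  rewrite ?comp_polyX ?comp_polyC IHc dE /= /horner_eval; ring.
have [c ->] := splitF F; set p := map_poly _ F.
have p0 : p != 0 by apply: monic_neq0; apply: monic_map.
(* Dividing [p] by the highest possible power of its variable leaves [r] with nonzero constant term,
   which [e] normalizes to 1. *)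
have [k [r /implyP/(_ p0) r0 ->]] := multiplicity_XsubC p 0.
have [d dE] := psi_comp_split r b; have [e eE] := psiC (r.[0]^-1).
rewrite rmorphM rmorphXn rmorphB /= comp_polyX comp_polyC subr0 dE => zero.
exists k, (e * d), (e * c).
have e1 : psi e * (r.[0])%:P = 1 by rewrite eE -polyCM mulVf.
rewrite !(rmorphD, rmorphM, rmorphXn, rmorph1) -[1]e1.
by rewrite -[RHS](mulr0 (psi e)) -zero; ring.
Qed.

End Dependence.

(** * Finite modules over a polynomial ring *)

(** A nonzero element of least degree divides all others, because remainders stay in [D]. *)
Lemma poly_ideal_principal (K : fieldType) (D : {poly K} -> Prop) :
    D 0 -> (forall p q, D p -> D q -> D (p + q)) ->
    (forall p q, D q -> D (p * q)) ->
  exists2 d, D d & forall p, D p -> d %| p.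
Proof.
move=> D0 DD DM.
have [[p0 [Dp0 p0_neq0]]|nD] := pselect (exists p, D p /\ p != 0); last first.
  exists 0 => // p Dp; rewrite dvd0p; apply: contrapT => /negP p0.
  by apply: nD; exists p.
pose S n := `[< exists p, [/\ D p, p != 0 & size p = n] >].
have exS : exists n, S n by exists (size p0); apply/asboolP; exists p0.
case: (ex_minnP exS) => _ /asboolP[d [Dd d0 <-]] min_d; exists d => // p Dp.
apply: contraT => pd0; have := ltn_modp p d; rewrite d0 ltnNge => /negP[].
apply: min_d; apply/asboolP; exists (p %% d); split=> //.
have -> : p %% d = p + (- (p %/ d)) * d.
  by apply/eqP; rewrite mulNr eq_sym subr_eq addrC -divp_eq.
by apply/DD/DM.
Qed.

Section ModuleFinite.
Variables (K : fieldType) (A : comPzRingType) (h : {rmorphism {poly K} -> A}).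
Implicit Types (es : seq A) (x y : A).

Fixpoint in_span es x : Prop :=
  if es is e :: es' then exists p y, in_span es' y /\ x = h p * e + y else x = 0.

Lemma in_span0 es : in_span es 0.
Proof.
by elim: es => //= e es IHes; exists 0, 0; rewrite rmorph0 mul0r addr0.
Qed.

Lemma in_spanD es x y : in_span es x -> in_span es y -> in_span es (x + y).
Proof.
elim: es x y => [|e es IHes] x y /=; first by move=> -> ->; rewrite addr0.
move=> [p [x' [sx ->]]] [q [y' [sy ->]]]; exists (p + q), (x' + y').
by split; [apply: IHes | rewrite rmorphD; ring].
Qed.

Lemma in_spanZ es p x : in_span es x -> in_span es (h p * x).
Proof.
elim: es x => [|e es IHes] x /=; first by move=> ->; rewrite mulr0.
move=> [q [y [sy ->]]]; exists (p * q), (h p * y).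
by split; [apply: IHes | rewrite rmorphM; ring].
Qed.

Lemma in_span_mem es x : x \in es -> in_span es x.
Proof.
elim: es => //= e es IHes; rewrite inE => /predU1P[->|/IHes sx].
  by exists 1, 0; split; [apply: in_span0 | rewrite rmorph1; ring].
by exists 0, x; split=> //; rewrite rmorph0; ring.
Qed.

Lemma in_span_sum es (I : Type) (r : seq I) (F : I -> A) :
  (forall i, in_span es (F i)) -> in_span es (\sum_(i <- r) F i).
Proof.
by move=> sF; elim/big_rec: _ => [|i x _]; [apply: in_span0 | apply: in_spanD].
Qed.

(** Induction on [es]: the possible coefficients at the head [e] of elements of [J] form a principal
    ideal. A lift of its generator is added to the generators of the part of [J] inside the span of
    the tail. *)
Lemma submodule_generated es (J : A -> Prop) :
    J 0 -> (forall x y, J x -> J y -> J (x + y)) ->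
    (forall p x, J x -> J (h p * x)) -> (forall x, J x -> in_span es x) ->
  exists xs : seq A, (forall x, x \in xs -> J x) /\
    forall x, J x -> x \in gen_ideal (fun y => y \in xs).
Proof.
elim: es J => [|e es IHes] J J0 JD JZ sJ.
  by exists [::]; split=> // x /sJ ->; apply: ideal0.
pose D p := exists y, in_span es y /\ J (h p * e + y).
have [|p q [x [sx Jx]] [y [sy Jy]]|p q [y [sy Jy]]|d [b [sb Jb]] dvd_d] :=
  @poly_ideal_principal K D.
- by exists 0; rewrite rmorph0 mul0r addr0; split=> //; apply: in_span0.
- exists (x + y); split; first exact: in_spanD.
  by have := JD _ _ Jx Jy; rewrite addrACA -mulrDl -rmorphD.
- exists (h p * y); split; first exact: in_spanZ.
  by have := JZ p _ Jy; rewrite mulrDr mulrA -rmorphM.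
have [||||xs [xsJ gen_xs]] := IHes (fun x => J x /\ in_span es x).
- by split=> //; apply: in_span0.
- by move=> x y [Jx sx] [Jy sy]; split; [apply: JD | apply: in_spanD].
- by move=> p x [Jx sx]; split; [apply: JZ | apply: in_spanZ].
- by move=> x [].
exists (h d * e + b :: xs); split=> [x|x Jx].
  by rewrite inE => /predU1P[-> //|/xsJ[]].
have [p [y [sy xE]]] := sJ x Jx.
have /dvdpP[q pE] : d %| p by apply: dvd_d; exists y; rewrite -xE.
have -> : x = h q * (h d * e + b) + (y + h (- q) * b).
  by rewrite xE pE rmorphM rmorphN; ring.
apply: idealD; first by apply/idealMl/mem_gen/mem_head.
have /gen_xs : J (y + h (- q) * b) /\ in_span es (y + h (- q) * b).
  split; last by apply/in_spanD/in_spanZ.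
  have -> : y + h (- q) * b = x + h (- q) * (h d * e + b).
    by rewrite xE pE rmorphM rmorphN; ring.
  by apply/JD/JZ.
by apply: gen_sub => z xs_z; apply: mem_gen; rewrite inE xs_z orbT.
Qed.

Lemma module_finite_noetherian es : (forall x, in_span es x) -> noetherian A.
Proof.
move=> spanA J.
have [||||xs [xsJ gen_xs]] := @submodule_generated es (fun x => x \in J).
- exact: ideal0.
- exact: idealD.
- by move=> p x; apply: idealMl.
- by move=> x _; apply: spanA.
exists xs => x; apply/idP/idP; first exact: gen_xs.
by apply: gen_sub => y; apply: xsJ.
Qed.

End ModuleFinite.

(** * Finite unions of parametrized curves *)

Lemma regular_seq0 (R : comPzRingType) (xs : seq R) a : (0 < size xs)%N ->
  regular_seq xs -> xs`_0 * a = 0 -> a = 0.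
Proof.
move=> xs0 [reg _] xa0; apply: (@gen0P _ (fun x => x \in take 0 xs)).
  by move=> y; rewrite take0.
by apply: reg; rewrite // xa0; apply: ideal0.
Qed.

Section CurveUnion.
Variables (K : fieldType) (A : comPzRingType) (T : finType).
(** The spectrum of [A] is to be pictured as a finite union of curves parametrized by the [psi t].
    Their kernels meet in 0, and [theta] is identically zero on no curve but vanishes at the point z
    = 0 of each. *)
Variable psi : T -> {rmorphism A -> {poly K}}.
Variables (theta : A) (t0 : T).
Hypothesis psiC : forall t (c : K), exists a, psi t a = c%:P.
Hypothesis psi_inj : forall a, (forall t, psi t a = 0) -> a = 0.
Hypothesis theta_neq0 : forall t, psi t theta != 0.
Hypothesis theta0 : forall t, (psi t theta).[0] = 0.
Hypothesis noeA : noetherian A.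
Implicit Types (P Q : prime_ideal A) (t : T).

Section Kernel.
Variable t : T.

Definition ker_mem : {pred A} := fun a => psi t a == 0.

Lemma mem_ker a : (a \in ker_mem) = (psi t a == 0). Proof. by []. Qed.

Lemma ker_closed : ideal_closed ker_mem.
Proof.
split=> [|a b|a b]; rewrite !mem_ker ?rmorph0 // ?rmorphD ?rmorphM.
  by move=> /eqP-> /eqP->; rewrite addr0.
by move=> /eqP->; rewrite mulr0.
Qed.

Lemma ker_prime : is_prime (Ideal ker_closed).
Proof.
split=> [|a b]; first by rewrite mem_ker rmorph1 oner_neq0.
by rewrite !mem_ker rmorphM mulf_eq0.
Qed.

Definition prime_ker : prime_ideal A := PrimeIdeal ker_prime.

Lemma mem_prime_ker a : (a \in prime_ker) = (psi t a == 0). Proof. by []. Qed.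

(** The prime of the point z = 0, used as the top of a chain of length 1. *)
Definition origin_mem : {pred A} := fun a => (psi t a).[0] == 0.

Lemma mem_origin a : (a \in origin_mem) = ((psi t a).[0] == 0). Proof. by []. Qed.

Lemma origin_closed : ideal_closed origin_mem.
Proof.
split=> [|a b|a b]; rewrite !mem_origin.
- by rewrite rmorph0 horner0.
- by rewrite rmorphD hornerD => /eqP-> /eqP->; rewrite addr0.
- by rewrite rmorphM hornerM => /eqP->; rewrite mulr0.
Qed.

Lemma origin_prime : is_prime (Ideal origin_closed).
Proof.
split=> [|a b]; first by rewrite mem_origin rmorph1 hornerE oner_neq0.
by rewrite !mem_origin rmorphM hornerM mulf_eq0.
Qed.

Definition prime_origin : prime_ideal A := PrimeIdeal origin_prime.

Lemma ker_sub_origin : {subset prime_ker <= prime_origin}.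
Proof. by move=> a; rewrite mem_prime_ker mem_origin => /eqP->; rewrite horner0. Qed.

End Kernel.

(** Otherwise each kernel has an element outside [P]; the product of these lies in all kernels,
    hence is 0, yet avoids the prime [P]. *)
Lemma prime_above_ker P : exists t, {subset prime_ker t <= P}.
Proof.
apply: contrapT => nP.
have /choice[a aP] t : exists a, a \in prime_ker t /\ a \notin P.
  have [|a ker_a Pa] := @not_subsetP _ (prime_ker t) P; last by exists a.
  by move=> kerP; apply: nP; exists t.
suff /eqP prod0 : \prod_t a t == 0.
  have : \prod_t a t \notin P by apply: prime_prod => t _; case: (aP t).
  by rewrite prod0 ideal0.
apply/eqP/psi_inj => t; apply/eqP.
have : a t * \prod_(y | y != t) a y \in prime_ker t.
  by apply: idealMr; case: (aP t).
by rewrite [X in psi t X](bigD1 t) //= mem_prime_ker.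
Qed.

(** The dependence between [theta] and [a] puts [theta] or some [1 + theta * b] into [P]. The latter
    takes the value 1 at z = 0 on every curve. *)
Lemma regular_mem P t a : {subset prime_ker t <= P} -> a \in P ->
  psi t a != 0 -> exists2 r, r \in P & forall y, psi y r != 0.
Proof.
move=> kerP Pa /(psi_dependence (psiC t) theta)[k [b [c zero]]].
have : theta ^+ k * (1 + theta * b) + a * c \in P by apply/kerP/eqP.
move/(fun h => idealB h (idealMr c Pa)); rewrite addrK => /primeM[/primeX|] Pr.
  by exists theta.
exists (1 + theta * b) => // y; apply: contraTneq isT => /(congr1 (horner^~ 0)).
rewrite rmorphD rmorph1 rmorphM !hornerE theta0 mul0r addr0 => /eqP.
by rewrite oner_eq0.
Qed.

(** An element of [prime_ker y] outside [prime_ker x] would yield, by [regular_mem], an element of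
    [prime_ker y] outside every kernel. *)
Lemma ker_incomparable x y :
  {subset prime_ker x <= prime_ker y} -> {subset prime_ker y <= prime_ker x}.
Proof.
move=> sxy a ay; apply: contraT => /(regular_mem sxy ay)[r].
by rewrite mem_prime_ker => /eqP r0 /(_ y); rewrite r0 eqxx.
Qed.

(** For [b] in [Q], the dependence puts [b ^+ k * (1 + b * b')] into [P]. If [b] is not in [P], then
    [1 + b * b'] is in [P], hence in [Q], and so is 1. *)
Lemma prime_maximal P Q t a : {subset prime_ker t <= P} -> a \in P ->
  psi t a != 0 -> {subset P <= Q} -> {subset Q <= P}.
Proof.
move=> kerP Pa a0 PQ b Qb; have [k [b' [c zero]]] := psi_dependence (psiC t) b a0.
have : b ^+ k * (1 + b * b') + a * c \in P by apply/kerP/eqP.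
move/(fun h => idealB h (idealMr c Pa)); rewrite addrK => /primeM[/primeX//|].
move/PQ/(fun h => idealB h (idealMr b' Qb)); rewrite addrK => Q1.
by case/negP: (prime1 Q).
Qed.

Lemma prime_chain_le1 P0 P1 P2 : {subset P0 <= P1} -> ~ {subset P1 <= P0} ->
  {subset P1 <= P2} -> {subset P2 <= P1}.
Proof.
move=> s01 n10 s12; have [t ker0] := prime_above_ker P0.
have [a a1 a0] := not_subsetP n10.
apply: (prime_maximal (t := t) _ a1) => //; first by move=> x /ker0/s01.
by apply: contraNN a0 => a0; apply: ker0.
Qed.

Lemma curve_dim1 : krull_dim A 1.
Proof.
split.
  exists (fun i => if i == 0%N then prime_ker t0 else prime_origin t0).
  case=> //= _; split; first exact: ker_sub_origin.
  move/(_ theta); rewrite mem_origin theta0 mem_prime_ker (negPf (theta_neq0 _)).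
  by move/(_ (eqxx _)).
case=> [|[|n]] // [P chP].
have [s01 n10] := chP 0%N isT; have [s12 n21] := chP 1%N isT.
by case: n21; apply: (prime_chain_le1 s01).
Qed.

(** [v] is a product of elements outside [prime_ker t], one from each kernel not contained in it.
    The remaining kernels equal [prime_ker t] and contain [a], so [v * a] lies in all kernels. *)
Lemma ker_annihilated t a : psi t a = 0 ->
  exists2 v, psi t v != 0 & v * a = 0.
Proof.
move=> a0.
have /choice[v vP] y : exists v, psi t v != 0 /\
    (~ {subset prime_ker y <= prime_ker t} -> psi y v = 0).
  have [|/not_subsetP[v vy vt]] := pselect {subset prime_ker y <= prime_ker t}.
    by exists 1; rewrite rmorph1 oner_neq0.
  by exists v; split=> // _; apply/eqP.
exists (\prod_y v y).
  by have := @prime_prod _ (prime_ker t) _ xpredT v; apply=> y _; case: (vP y).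
apply: psi_inj => y; rewrite rmorphM (bigD1 y) //= rmorphM.
have [sub|nsub] := pselect {subset prime_ker y <= prime_ker t}; last first.
  by case: (vP y) => _ /(_ nsub)->; rewrite !mul0r.
have /(ker_incomparable sub) : a \in prime_ker t by apply/eqP.
by rewrite mem_prime_ker => /eqP->; rewrite mulr0.
Qed.

(** Locally at [P], some power of [b] is a multiple of [a]. Elements of the form [good] are closed
    under products, so it suffices to find one in each kernel: by dependence if the kernel lies in
    [P], and otherwise with [k] = 0 by an element outside [P]. *)
Lemma power_divisible P a b :
    (forall t, {subset prime_ker t <= P} -> psi t a != 0) -> b \in P ->
  exists k w c, w \notin P /\ b ^+ k * w + a * c = 0.
Proof.
move=> a_neq0 Pb.
pose good e := exists k w c, w \notin P /\ e = b ^+ k * w + a * c.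
have /choice[e eP] t : exists e, good e /\ psi t e = 0.
  have [sub|/not_subsetP[w wt wP]] := pselect {subset prime_ker t <= P}.
    have [k [b' [c zero]]] := psi_dependence (psiC t) b (a_neq0 t sub).
    exists (b ^+ k * (1 + b * b') + a * c); split=> //.
    exists k, (1 + b * b'), c; split=> //; apply/negP.
    move/(fun h => idealB h (idealMr b' Pb)); rewrite addrK.
    exact/negP/prime1.
  exists w; split; last exact/eqP.
  by exists 0%N, w, 0; split=> //; ring.
have [k [w [c [wP prodE]]]] : good (\prod_t e t).
  apply: big_rec; first by exists 0%N, 1, 0; split; [apply: prime1 | ring].
  move=> t _ _ [k [w [c [wP ->]]]]; have [[k' [w' [c' [wP' ->]]]] _] := eP t.
  exists (k' + k)%N, (w' * w), (b ^+ k' * w' * c + c' * b ^+ k * w + a * c * c').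
  by split; [apply: prime_notM | rewrite exprD; ring].
exists k, w, c; split=> //; rewrite -prodE; apply: psi_inj => t.
by rewrite (bigD1 t) //= rmorphM (eP t).2 mul0r.
Qed.

(** * Dimension and depth of the local rings *)

Section Localized.
Variable P : prime_ideal A.
Local Notation L := (localization P).

(** By [ker_annihilated] the maximal ideal of the local ring is zero, and 0 cannot start a regular
    sequence in a nonzero ring. *)
Lemma minimal_depth t : P =i prime_ker t -> depth (loc_max P) 0.
Proof.
move=> PE; split=> [|n [xs [<- xsM]]].
  by exists [::]; split=> //; split=> //; apply/negP => /gen0P e;
    case/negP: (prime1 (loc_max P)); rewrite e ?ideal0.
case: xs xsM => // x xs xsM /regular_seq0 reg.
have /xsM : x \in x :: xs by rewrite mem_head.
have [a [u xE]] := frac_surj x; rewrite xE mem_loc_max PE => /eqP.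
case/ker_annihilated=> v v0 va0.
have Pv : v \notin P by rewrite PE.
have a0 : x = 0 by rewrite xE; apply/frac_eq0; exists (mkdenom Pv).
case/negP: (prime1 (loc_max P)).
by rewrite (reg 1) ?ideal0 //= a0 mul0r.
Qed.

Lemma minimal_dim t : P =i prime_ker t -> krull_dim L 0.
Proof.
move=> PE; split=> [|[|n] // /loc_chain[Q [QP chQ]]].
  by exists (fun=> loc_max P).
have [s01 n10] := chQ 0%N isT; have [y ker0] := prime_above_ker (Q 0%N).
case: n10 => a /QP; rewrite PE => ta; apply/ker0/ker_incomparable/ta.
by move=> b yb; rewrite -PE; apply/(QP 0%N)/ker0.
Qed.

Lemma nonminimal_dim t a :
  {subset prime_ker t <= P} -> a \in P -> psi t a != 0 -> krull_dim L 1.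
Proof.
move=> kerP Pa a0; split; first exact: loc_chain1 kerP Pa a0.
case=> [|[|n]] // /loc_chain[Q [QP chQ]].
have [s01 n10] := chQ 0%N isT; have [s12 n21] := chQ 1%N isT.
by case: n21; apply: (prime_chain_le1 s01).
Qed.

(** The element of [regular_mem] is a regular sequence of length 1. In a longer one, a power of the
    second entry would be a multiple of the first, contradicting regularity. *)
Lemma nonminimal_depth t a :
  {subset prime_ker t <= P} -> a \in P -> psi t a != 0 -> depth (loc_max P) 1.
Proof.
move=> kerP Pa a0; split=> [|n].
  have [r Pr r0] := regular_mem kerP Pa a0.
  have r_in : frac r (denom1 P) \in loc_max P by rewrite mem_loc_max.
  exists [:: frac r (denom1 P)]; split=> //; first by move=> x /[!inE]/eqP->.
  split=> [[|//] z _ J rz|]; last first.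
    by apply: contra (prime1 (loc_max P)); apply: gen_sub => x /[!inE]/eqP->.
  suff -> : z = 0 by apply: ideal0.
  have {rz} : frac r (denom1 P) * z = 0 by apply: (gen0P _ rz).
  have [b [u ->]] := frac_surj z; rewrite frac_mul.
  case/frac_eq0 => w rb0; apply/frac_eq0; exists w.
  apply: psi_inj => y; move/(congr1 (psi y)): rb0.
  rewrite !rmorphM rmorph0 => /eqP; rewrite !mulf_eq0 (negPf (r0 y)) /=.
  by rewrite -mulf_eq0 => /eqP.
case=> [xs [<- xsM reg]]; rewrite leqNgt; apply/negP => size_xs.
have size0 := ltnW size_xs.
have M0 : xs`_0 \in loc_max P by apply/xsM/mem_nth.
have M1 : xs`_1 \in loc_max P by apply/xsM/mem_nth.
have [b [u bE]] := frac_surj xs`_0; have [d [v dE]] := frac_surj xs`_1.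
(* If [b] vanished on a curve through [P], an annihilator [w] of [b] nonzero on that curve would be
   0 in the local ring. Some [h] outside [P] would then kill [w], hence vanish on the curve and lie
   in [P]. *)
have b_neq0 y : {subset prime_ker y <= P} -> psi y b != 0.
  move=> kerPy; apply/negP => /eqP /ker_annihilated[w w0 wb0].
  have /frac_eq0[h /(congr1 (psi y))] : tofrac P w = 0.
    apply: (regular_seq0 size0 reg); rewrite bE frac_mul mulrC wb0.
    exact: frac0.
  move/eqP; rewrite rmorph0 rmorphM mulf_eq0 (negPf w0) orbF => /kerPy Ph.
  by have := valP h; rewrite Ph.
have Pd : d \in P by rewrite -(mem_loc_max d v) -dE.
have [k [w [c [Pw zero]]]] := power_divisible b_neq0 Pd.
pose J := gen_ideal (fun x => x \in take 1 xs).
have Jx : xs`_0 \in J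
  by apply: mem_gen; rewrite -(@nth_take 1) // mem_nth // size_takel.
have Jb : tofrac P b \in J by rewrite -(mem_frac J b u) -bE.
have Jk : xs`_1 ^+ k \in J.
  suff : tofrac P d ^+ k \in J.
    by move=> Jd; rewrite dE fracE exprMn; apply: idealMr.
  rewrite -tofracX -(mem_frac J _ (denom1 P)).
  have -> : frac (d ^+ k) (denom1 P) = frac (- (b * c)) (mkdenom Pw).
    apply: frac_eq1 => /=; rewrite mulr1; apply/eqP.
    by rewrite -addr_eq0 zero.
  by rewrite mem_frac -mulrN tofracM; apply: idealMr.
have regJ := (reg.1 1%N _ size_xs); rewrite -/J in regJ.
(* Regularity of the second entry modulo [J] cancels the factors of its power one by one. *)
have J1 : 1 \in J.
  elim: k Jk {zero} => [|k IHk]; first by rewrite expr0.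
  by rewrite exprS => /regJ.
case/negP: reg.2; move: 1 J1; apply: gen_sub => x /mem_take x_in.
exact: mem_gen.
Qed.

End Localized.

Lemma curve_cohen_macaulay : cohen_macaulay A.
Proof.
split=> // P; split; first exact: loc_noetherian.
have [t kerP] := prime_above_ker P; exists (loc_max P).
have [PE|] := pselect {subset P <= prime_ker t}.
  have {}PE : P =i prime_ker t by move=> a; apply/idP/idP; [apply: PE|apply: kerP].
  exists 0%N; split; first exact: loc_is_local.
    exact: minimal_dim PE.
  exact: minimal_depth PE.
case/not_subsetP=> a Pa a0; exists 1%N; split; first exact: loc_is_local.
  exact: nonminimal_dim kerP Pa a0.
exact: nonminimal_depth kerP Pa a0.
Qed.

End CurveUnion.

(** * Character sums and the lattice ideal *)

Section UnitSums.
Variable K : finFieldType.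
Implicit Types (u : {unit K}) (k : nat).

Lemma unit_expr_card u : val u ^+ #|K|.-1 = 1.
Proof.
by rewrite -card_finField_unit -FinRing.val_unitX expg_cardG ?inE.
Qed.

Lemma expr_mod_card u k l :
  (k %% #|K|.-1 = l %% #|K|.-1)%N -> val u ^+ k = val u ^+ l.
Proof.
move=> kl; rewrite -[LHS](expr_mod _ (unit_expr_card u)) kl.
by rewrite expr_mod ?unit_expr_card.
Qed.

(** As q = 0 in [K], this number is -1. *)
Lemma card_units_neq0 : (#|K|.-1)%:R != 0 :> K.
Proof.
have card0 : (#|K|)%:R = 0 :> K.
  by rewrite -cardsT -FinRing.zmodXgE expg_cardG ?inE.
have := card0; rewrite -(ltn_predK (finNzRing_gt1 K)) mulrS => /eqP.
by apply: contraTneq => ->; rewrite addr0 oner_eq0.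
Qed.

Lemma unit_sum k :
  \sum_(u : {unit K}) val u ^+ k = if (#|K|.-1 %| k)%N then (#|K|.-1)%:R else 0.
Proof.
have cardU : #|{: {unit K}}| = #|K|.-1 by rewrite -cardsT card_finField_unit.
case: ifP => [k0|k_ndvd].
  rewrite (eq_bigr (fun=> 1)) => [|u _]; first by rewrite sumr_const cardU.
  by rewrite -(expr0 (val u)); apply: expr_mod_card; rewrite mod0n; apply/eqP.
(* Otherwise all q - 1 units would be roots of unity of the smaller positive order k mod (q - 1).
   Multiplication by [v] then permutes the units and scales the sum by a factor other than 1. *)
have [v v_neq1] : exists v : {unit K}, val v ^+ k != 1.
  apply: contrapT => nv; have all1 u : val u ^+ (k %% #|K|.-1) = 1.
    rewrite expr_mod ?unit_expr_card //; apply/eqP/negPn/negP => u1.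
    by apply: nv; exists u.
  pose rs := [seq val u | u <- enum {: {unit K}}].
  have k_gt0 : (0 < k %% #|K|.-1)%N by rewrite lt0n; apply/negbT.
  have card_gt0 : (0 < #|K|.-1)%N by rewrite -cardU; apply/card_gt0P; exists 1%g.
  have /(max_unity_roots k_gt0) : all (k %% #|K|.-1).-unity_root rs.
    by apply/allP => _ /mapP[u _ ->]; rewrite unity_rootE all1.
  rewrite map_inj_uniq ?enum_uniq; last exact: val_inj.
  by rewrite size_map -cardE cardU leqNgt ltn_pmod // => /(_ isT).
have sumE : \sum_(u : {unit K}) val u ^+ k =
    val v ^+ k * \sum_(u : {unit K}) val u ^+ k.
  rewrite {1}(reindex_inj (mulgI v)) mulr_sumr; apply: eq_bigr => u _.
  by rewrite -exprMn.
have : (val v ^+ k - 1) * \sum_(u : {unit K}) val u ^+ k = 0.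
  by rewrite mulrBl mul1r -sumE subrr.
by move/eqP; rewrite mulf_eq0 subr_eq0 (negPf v_neq1) => /eqP.
Qed.

End UnitSums.

(** * Curves through torus points and the two ideals *)

Section Torus.
Variables (K : finFieldType) (s : nat) (w : 'I_s -> nat).
Local Notation point := {ffun 'I_s -> {unit K}}.
Implicit Types (t : point) (a b m : 'X_{1..s}) (f : {mpoly K[s]}).

Definition chr t m : K := \prod_i val (t i) ^+ m i.

(* The [curve t] evaluate polynomials along the orbits [(t_i z ^ w_i)_i] of
   the torus points, with [z] the variable of the target. *)
Definition curve t : {rmorphism {mpoly K[s]} -> {poly K}} :=
  mmap polyC (fun i => (val (t i))%:P * 'X^(w i)).

Lemma curve_const t c : curve t c%:MP = c%:P.
Proof. exact: mmapC. Qed.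

Lemma curveX t m : curve t 'X_[m] = chr t m *: 'X^(wdeg w m).
Proof.
rewrite [LHS]mmapX /mmap1 -mul_polyC /chr rmorph_prod /wdeg -prodrXr -big_split.
by apply: eq_bigr => i _; rewrite exprMn rmorphXn -exprM mulnC.
Qed.

Lemma curveE t f :
  curve t f = \sum_(m <- msupp f) (f@_m * chr t m) *: 'X^(wdeg w m).
Proof.
rewrite {1}[f]mpolyE rmorph_sum; apply: eq_bigr => m _.
by rewrite -mul_mpolyC rmorphM /= curve_const curveX mul_polyC scalerA.
Qed.

(** A boolean form of a - b being in the lattice, see [torus_latticeP]: equal degrees express
    orthogonality to [w], the congruences divisibility by q - 1. *)
Definition congr_mnm a b :=
  (wdeg w a == wdeg w b) && [forall i, (a i %% #|K|.-1 == b i %% #|K|.-1)%N].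

Lemma congr_mnmP a b :
  reflect (wdeg w a = wdeg w b /\ forall i, (a i %% #|K|.-1 = b i %% #|K|.-1)%N)
    (congr_mnm a b).
Proof.
apply: (iffP andP) => -[/eqP wab ab]; split=> //.
  by move=> i; apply/eqP/(forallP ab).
by apply/forallP => i; apply/eqP.
Qed.

Lemma congr_chr t a b : congr_mnm a b -> chr t a = chr t b.
Proof.
by case/congr_mnmP=> _ ab; apply: eq_bigr => i _; apply/expr_mod_card/ab.
Qed.

Lemma card_pred_gt0 : (0 < #|K|.-1)%N.
Proof. by rewrite -card_finField_unit cardG_gt0. Qed.

Lemma torus_latticeP a b :
  torus_lattice #|K| w (\row_i ((a i)%:Z - (b i)%:Z)) <-> congr_mnm a b.
Proof.
have q0 : (#|K|.-1%:Z != 0) by have := card_pred_gt0; lia.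
have wdegZ c : (wdeg w c)%:Z = \sum_i (c i)%:Z * (w i)%:Z.
  by rewrite /wdeg -natz raddf_sum /=; apply: eq_bigr => i _; rewrite natz PoszM.
rewrite /torus_lattice /orth_lattice subn1; split.
  case=> u u0 /rowP ab; apply/congr_mnmP.
  have {}ab i : (a i)%:Z = (b i)%:Z + u 0 i * #|K|.-1%:Z.
    have := ab i; rewrite mxE mulmxnE -mulr_natr natz => /eqP.
    by rewrite subr_eq addrC => /eqP.
  split=> [|i]; last first.
    by apply/eqP; rewrite -eqz_nat -!modz_nat ab addrC modzMDl.
  apply/eqP; rewrite -eqz_nat !wdegZ.
  rewrite (eq_bigr (fun i => (b i)%:Z * (w i)%:Z + #|K|.-1%:Z * (u 0 i * (w i)%:Z))).
    by rewrite big_split /= -mulr_sumr u0 mulr0 addr0.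
  by move=> i _; rewrite ab; ring.
case/congr_mnmP=> wab ab.
pose u := \row_(i < s) ((((a i)%:Z - (b i)%:Z) %/ #|K|.-1)%Z).
have uE i : (a i)%:Z - (b i)%:Z = u 0 i * #|K|.-1%:Z.
  rewrite mxE divzK // -eqz_mod_dvd !modz_nat; apply/eqP.
  by rewrite ab.
exists u; last by apply/rowP => i; rewrite mxE uE mulmxnE -mulr_natr natz.
(* [u] is orthogonal to [w] because its multiple by the nonzero integer q - 1 is. *)
apply: (mulfI q0); rewrite mulr0 mulr_sumr.
rewrite (eq_bigr (fun i => (a i)%:Z * (w i)%:Z - (b i)%:Z * (w i)%:Z)).
  by rewrite sumrB -!wdegZ wab subrr.
by move=> i _; rewrite -mulrBl uE; ring.
Qed.

Lemma congr_lattice_ideal a b : congr_mnm a b ->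
  'X_[a] - 'X_[b] \in lattice_ideal K (torus_lattice #|K| w).
Proof. by move/torus_latticeP=> ab; apply: mem_gen; exists a, b. Qed.

(* Orthogonality of the characters of [K^* ^ s], applied to each coefficient
   of the polynomials [curve t f]. *)
Lemma curve_class_sum f b : (forall t, curve t f = 0) ->
  \sum_(m <- msupp f | congr_mnm m b) f@_m = 0.
Proof.
(* [c i] is a natural number representing -b_i modulo q - 1, so that [c] gives the inverse of the
   character of [b]. *)
move=> f0; pose c i := (#|K|.-1 - b i %% #|K|.-1)%N.
have sumT m : \sum_(t : point) \prod_i val (t i) ^+ (m i + c i) =
    if [forall i, (m i %% #|K|.-1 == b i %% #|K|.-1)%N]
    then (#|K|.-1)%:R ^+ s else 0 :> K.
  rewrite -(bigA_distr_bigA (fun i (u : {unit K}) => val u ^+ (m i + c i))).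
  rewrite (eq_bigr (fun i => if (m i %% #|K|.-1 == b i %% #|K|.-1)%N
                             then (#|K|.-1)%:R else 0)).
    case: ifPn => [/forallP mb|/forallPn[i /negPf mb]].
      rewrite (eq_bigr (fun=> (#|K|.-1)%:R)) => [|i _]; last by rewrite mb.
      by rewrite prodr_const card_ord.
    by rewrite (bigD1 i) //= mb mul0r.
  move=> i _; rewrite unit_sum; congr (if _ then _ else _).
  have bc0 : ((b i + c i) %% #|K|.-1 = 0)%N.
    by rewrite -modnDml subnKC ?modnn // ltnW // ltn_pmod // card_pred_gt0.
  by rewrite -(eqn_modDr (c i)) bc0.
have [d dE] : exists d, d = wdeg w b by exists (wdeg w b).
have coef0 t : \sum_(m <- msupp f | wdeg w m == d) f@_m * chr t m = 0.
  have /(congr1 (coefp d)) := f0 t; rewrite curveE raddf_sum raddf0 /= => e.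
  rewrite -[RHS]e [LHS]big_mkcond; apply: eq_bigr => m _.
  by rewrite coefZ coefXn eq_sym; case: eqP => _; rewrite ?mulr1 ?mulr0.
have : \sum_(t : point) (\prod_i val (t i) ^+ c i) *
    (\sum_(m <- msupp f | wdeg w m == d) f@_m * chr t m) = 0.
  by apply: big1 => t _; rewrite coef0 mulr0.
under eq_bigr do rewrite mulr_sumr.
rewrite exchange_big /= => sum0.
(* Summing over all points leaves the class of [b], weighted by the order (q - 1)^s of the group,
   which is nonzero in [K]. *)
apply: (mulfI (expf_neq0 s (card_units_neq0 K))); rewrite mulr0 -[RHS]sum0.
rewrite mulr_sumr dE [LHS]big_mkcond [RHS]big_mkcond; apply: eq_bigr => m _.
rewrite /congr_mnm; case: eqP => //= _.
rewrite (eq_bigr (fun t => f@_m * \prod_i val (t i) ^+ (m i + c i))).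
  by rewrite -mulr_sumr sumT; case: ifP => _; rewrite ?mulr0 // mulrC.
move=> t _; rewrite mulrCA; congr (_ * _); rewrite -big_split.
by apply: eq_bigr => i _; rewrite /= addnC exprD.
Qed.

(** Replacing each monomial by a representative [rho] of its class changes [f] by an element of the
    lattice ideal and leaves 0, since the coefficients of each class sum to 0. *)
Lemma curve_lattice_ideal f : (forall t, curve t f = 0) ->
  f \in lattice_ideal K (torus_lattice #|K| w).
Proof.
move=> f0; pose rho m := choose (congr_mnm m) m.
have refl m : congr_mnm m m by apply/congr_mnmP.
have rhoP m : congr_mnm m (rho m) by apply: (@chooseP _ (congr_mnm m)).
have rho_eq m b : congr_mnm m b -> rho m = rho b.
  move=> /congr_mnmP[wmb mb].
  have e : congr_mnm m =1 congr_mnm b.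
    move=> x; apply/congr_mnmP/congr_mnmP => -[wx ex].
      by split=> [|i]; rewrite -?wmb -?mb.
    by split=> [|i]; rewrite ?wmb ?mb.
  rewrite /rho (eq_choose e); apply: choose_id => //.
  by rewrite -e; apply/congr_mnmP.
have -> : f = \sum_(m <- msupp f) (f@_m)%:MP * ('X_[m] - 'X_[rho m]).
  rewrite [LHS]mpolyE; apply/eqP; rewrite -subr_eq0 -sumrB; apply/eqP/mpolyP => n.
  rewrite raddf_sum mcoeff0 /=.
  rewrite (eq_bigr (fun m => if rho m == n then f@_m else 0)) => [|m _]; last first.
    rewrite mulrBr mul_mpolyC opprB addrC subrK mcoeffCM mcoeffX.
    by case: eqP => _; rewrite ?mulr1 ?mulr0.
  rewrite -big_mkcond /=.
  (* The coefficient at [n] is a full class sum if [n] is a representative, and an empty sum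
     otherwise. *)
  have [[m0 /eqP rho_m0]|no] := pselect (exists m0, rho m0 == n); last first.
    by apply: big1 => m mn; case: no; exists m.
  rewrite -[RHS](curve_class_sum m0 f0); apply: eq_bigl => m.
  apply/eqP/idP => [mn|/rho_eq->//].
  have /congr_mnmP[w1 e1] := rhoP m; have /congr_mnmP[w2 e2] := rhoP m0.
  apply/congr_mnmP; split=> [|i]; first by rewrite w1 w2 mn rho_m0.
  by rewrite e1 e2 mn rho_m0.
by apply: ideal_sum => m _; apply/idealMl/congr_lattice_ideal.
Qed.

(** [wtorus] asks for one representative with nonzero coordinates; scaling carries this over to all
    of them. *)
Lemma wtorus_coords (x : nzvec K s) :
  \pi_(wproj K w) x \in @wtorus K s w -> forall i, val x 0 i != 0.
Proof.
case/existsP=> y /andP[/eqP/eqmodP/existsP[l /andP[l0 /eqP xE]] /prodf_neq0 y0] i.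
by rewrite xE mxE mulf_neq0 ?expf_neq0 // y0.
Qed.

Lemma lattice_sub_vanishing :
  {subset lattice_ideal K (torus_lattice #|K| w) <= vanishing_ideal (@wtorus K s w)}.
Proof.
apply: gen_sub => _ [a [b [/torus_latticeP ab ->]]]; apply: mem_gen.
have /congr_mnmP[wab eab] := ab.
split; first by exists (wdeg w b); apply: rpredB; rewrite dhomogX /= ?wab.
move=> x /wtorus_coords x0; rewrite mevalB !mevalX.
pose t : point := [ffun i => finField_unit (x0 i)].
apply/eqP; rewrite subr_eq0; apply/eqP.
have := congr_chr t ab; rewrite /chr.
by under eq_bigr do rewrite ffunE; under [in RHS]eq_bigr do rewrite ffunE.
Qed.

Lemma curve_homog t d f : f \is d.-homog for (wdeg w) ->
  curve t f = f.@[fun i => val (t i)] *: 'X^d.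
Proof.
move/dhomogP=> fd; rewrite curveE mevalE scaler_suml [LHS]big_seq [RHS]big_seq.
by apply: eq_bigr => m /fd <-.
Qed.

Lemma curve_vanishing t f (i0 : 'I_s) :
  f \in vanishing_ideal (@wtorus K s w) -> curve t f = 0.
Proof.
case/asboolP=> n [c [g [gP ->]]]; rewrite rmorph_sum; apply: big1 => i _.
have [[d homog_g] van_g] := gP i; rewrite rmorphM (curve_homog _ homog_g).
pose v : 'rV[K]_s := \row_j val (t j).
have v_neq0 j : v 0 j != 0 by rewrite mxE -unitfE (valP (t j)).
(* The index [i0] witnesses that s is positive, without which [v] would be the zero vector. *)
have v0 : v != 0 by apply: contraNneq (v_neq0 i0) => ->; rewrite mxE.
pose x : nzvec K s := exist (fun v => is_true (v != 0)) v v0.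
have -> : (g i).@[fun j => val (t j)] = (g i).@[fun j => val x 0 j].
  by apply: meval_eq => j; rewrite /= mxE.
rewrite van_g ?scale0r ?mulr0 //; apply/existsP; exists x.
by rewrite eqxx; apply/prodf_neq0 => j _; apply: v_neq0.
Qed.

(** This closes the circle of inclusions: vanishing ideal, intersection of the kernels, lattice
    ideal, vanishing ideal. *)
Lemma vanishing_curveP (i0 : 'I_s) f :
  f \in vanishing_ideal (@wtorus K s w) <-> forall t, curve t f = 0.
Proof.
split=> [fI t|/curve_lattice_ideal/lattice_sub_vanishing//].
exact: curve_vanishing.
Qed.

End Torus.

(** * The coordinate ring of the torus *)

Section QuotientMaps.
Variables (R : comPzRingType) (I : ideal R).

Definition quot_pi (x : R) : quot_ring I := \pi x.

Lemma quot_pi_zmod : zmod_morphism quot_pi.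
Proof.
move=> x y; apply: (addIr (quot_pi y)); rewrite subrK.
by rewrite /quot_pi -[LHS]Quotient.pi_add subrK.
Qed.

Lemma quot_pi_monoid : monoid_morphism quot_pi.
Proof.
split=> [|x y]; last exact: quot_pi_mul.
by rewrite -[1 in RHS]/(quot_one I) /quot_one; unlock.
Qed.

HB.instance Definition _ :=
  GRing.isZmodMorphism.Build R (quot_ring I) quot_pi quot_pi_zmod.
HB.instance Definition _ :=
  GRing.isMonoidMorphism.Build R (quot_ring I) quot_pi quot_pi_monoid.

Lemma quot_pi_surj (z : quot_ring I) : exists x, z = quot_pi x.
Proof. by exists (repr z); rewrite /quot_pi reprK. Qed.

Lemma quot_pi_eq0 x : quot_pi x = 0 <-> x \in I.
Proof. by rewrite -(rmorph0 quot_pi) quot_pi_eq subr0. Qed.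

Variables (S : comPzRingType) (f : {rmorphism R -> S}).
Hypothesis f0 : forall x, x \in I -> f x = 0.

(* The proof argument makes the morphism instances of [quot_lift f0] inferable. *)
Definition quot_lift (_ : forall x, x \in I -> f x = 0) (z : quot_ring I) : S :=
  f (repr z).

Lemma quot_liftE x : quot_lift f0 (quot_pi x) = f x.
Proof.
apply/eqP; rewrite -subr_eq0 -rmorphB f0 //.
by apply/quot_pi_eq; rewrite reprK.
Qed.

Lemma quot_lift_zmod : zmod_morphism (quot_lift f0).
Proof.
move=> x y; have [a ->] := quot_pi_surj x; have [b ->] := quot_pi_surj y.
by rewrite -rmorphB !quot_liftE rmorphB.
Qed.

Lemma quot_lift_monoid : monoid_morphism (quot_lift f0).
Proof.
split=> [|x y]; first by rewrite -(rmorph1 quot_pi) quot_liftE rmorph1.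
have [a ->] := quot_pi_surj x; have [b ->] := quot_pi_surj y.
by rewrite -rmorphM !quot_liftE rmorphM.
Qed.

HB.instance Definition _ :=
  GRing.isZmodMorphism.Build (quot_ring I) S (quot_lift f0) quot_lift_zmod.
HB.instance Definition _ :=
  GRing.isMonoidMorphism.Build (quot_ring I) S (quot_lift f0) quot_lift_monoid.

End QuotientMaps.

Section TorusRing.
Variables (K : finFieldType) (s : nat) (w : 'I_s -> nat) (i0 : 'I_s).
Hypothesis w_gt0 : forall i, (0 < w i)%N.
Local Notation point := {ffun 'I_s -> {unit K}}.
Local Notation I_T := (vanishing_ideal (@wtorus K s w)).
Local Notation A := (quot_ring I_T).

Definition torus_curve (t : point) : {rmorphism A -> {poly K}} :=
  quot_lift (fun f => @curve_vanishing K s w t f i0).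

Lemma torus_curve_pi t f : torus_curve t (quot_pi I_T f) = curve w t f.
Proof. exact: quot_liftE. Qed.

Lemma torus_curve_inj (z : A) : (forall t, torus_curve t z = 0) -> z = 0.
Proof.
have [f ->] := quot_pi_surj z => f0.
by apply/quot_pi_eq0/(vanishing_curveP w i0) => t; rewrite -torus_curve_pi.
Qed.

Lemma torus_curve_const t (c : K) : exists z, torus_curve t z = c%:P.
Proof. by exists (quot_pi _ c%:MP); rewrite torus_curve_pi curve_const. Qed.

(** This coordinate plays the role of [theta]. *)
Definition torus_coord : A := quot_pi _ 'X_i0.

Lemma torus_curve_coord t :
  torus_curve t torus_coord = (val (t i0))%:P * 'X^(w i0).
Proof. by rewrite torus_curve_pi [LHS]mmapX mmap1U. Qed.

Lemma torus_curve_coord_neq0 t : torus_curve t torus_coord != 0.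
Proof.
rewrite torus_curve_coord mulf_neq0 ?polyC_eq0 ?monic_neq0 ?monicXn //.
by rewrite -unitfE (valP (t i0)).
Qed.

Lemma torus_curve_coord0 t : (torus_curve t torus_coord).[0] = 0.
Proof. by rewrite torus_curve_coord !hornerE expr0n eqn0Ngt w_gt0 mulr0. Qed.

Definition torus_param : {rmorphism {poly K} -> A} :=
  quot_pi I_T \o horner_alg ('X_i0 : {mpoly K[s]}).

Lemma torus_paramE c n :
  torus_param (c *: 'X^n) = quot_pi I_T (c *: 'X_[(U_(i0) *+ n)%MM]).
Proof. by rewrite /= linearZ /= rmorphXn /= horner_algX mpolyXn mulr_algl. Qed.

(* As [t_i ^+ ((q - 1) * w i0)] and [t_i0 ^+ ((q - 1) * w i)] agree modulo the
   lattice ideal, exponents can be reduced modulo [(q - 1) * w i0]. *)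
Lemma torus_noetherian : noetherian A.
Proof.
pose M := (#|K|.-1 * w i0)%N.
have M_gt0 : (0 < M)%N by rewrite muln_gt0 card_pred_gt0 w_gt0.
pose e (r : {ffun 'I_s -> 'I_M}) : A := quot_pi _ 'X_[[multinom r i : nat | i < s]].
apply: (@module_finite_noetherian _ _ torus_param (codom e)) => z.
have [f ->] := quot_pi_surj z; rewrite [f]mpolyE rmorph_sum.
apply: in_span_sum => m /=.
pose r := [ffun i : 'I_s => Ordinal (ltn_pmod (m i) M_gt0)].
(* Each factor t_i^M is traded for t_i0 to the power (q - 1) w_i. This has the same degree, and both
   exponents are multiples of q - 1. *)
pose n := (\sum_i (m i %/ M) * w i * #|K|.-1)%N.
have -> : quot_pi I_T (f@_m *: 'X_[m]) = torus_param (f@_m *: 'X^n) * e r.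
  rewrite torus_paramE -rmorphM -scalerAl -mpolyXD; apply/eqP.
  rewrite -subr_eq0 -rmorphB -scalerBr -mul_mpolyC; apply/eqP/quot_pi_eq0.
  apply/idealMl/lattice_sub_vanishing/congr_lattice_ideal/congr_mnmP; split.
    rewrite wdegD addnC.
    have -> : wdeg w (U_(i0) *+ n)%MM = (n * w i0)%N.
      rewrite /wdeg (bigD1 i0) //= big1 ?addn0 => [|i i_neq]; rewrite mulmnE mnmE.
        by rewrite eqxx mul1n.
      by rewrite eq_sym (negPf i_neq) mul0n.
    rewrite /wdeg /n big_distrl -big_split; apply: eq_bigr => i _ /=.
    rewrite mnmE ffunE /= {1}(divn_eq (m i) M); set k := (m i %/ M)%N.
    by rewrite /M; ring.
  move=> i; rewrite mnmDE mulmnE !mnmE ffunE /=.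
  have n0 : (n %% #|K|.-1 = 0)%N.
    by apply/eqP/dvdn_sum => j _; apply: dvdn_mull.
  rewrite -modnDml -modnMmr n0 muln0 mod0n add0n modn_dvdm //.
  exact: dvdn_mulr.
by apply/in_spanZ/in_span_mem/codom_f.
Qed.

Lemma torus_dim : krull_dim A 1.
Proof.
apply: (@curve_dim1 _ _ _ torus_curve torus_coord [ffun=> 1%g]).
- exact: torus_curve_const.
- exact: torus_curve_inj.
- exact: torus_curve_coord_neq0.
- exact: torus_curve_coord0.
Qed.

Lemma torus_cohen_macaulay : cohen_macaulay A.
Proof.
apply: (@curve_cohen_macaulay _ _ _ torus_curve torus_coord).
- exact: torus_curve_const.
- exact: torus_curve_inj.
- exact: torus_curve_coord_neq0.
- exact: torus_curve_coord0.
- exact: torus_noetherian.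
Qed.

End TorusRing.

Theorem theorem2p8 (K : finFieldType) (q : nat) (hq : #|K| = q)
  (s : nat) (hs : (1 <= s)%N)
  (w : 'I_s -> nat) (hw : forall i, (0 < w i)%N)
  (hgcd : \big[gcdn/0%N]_(i < s) w i = 1%N) :
  let I_T : ideal {mpoly K[s]} := vanishing_ideal (@wtorus K s w) in
  let I_L : ideal {mpoly K[s]} := lattice_ideal K (torus_lattice q w) in
  [/\ I_T =i I_L, krull_dim (quot_ring I_T) 1 & cohen_macaulay (quot_ring I_T)].
Proof.
move=> I_T I_L; pose i0 := Ordinal hs; subst q; split.
- move=> f; apply/idP/idP; last exact: lattice_sub_vanishing.
  by move/(vanishing_curveP w i0); apply: curve_lattice_ideal.
- exact: (torus_dim K i0 hw).
- exact: (torus_cohen_macaulay K i0 hw).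
Qed.
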